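(* Let $X$ be a Banach space, $p\ge 1$, and let $B:X\to X$ be a linear operator that has a degenerate skeleton chain $\{B^i\}_{i=0}^p$ of length $p$ (as defined in the context), i.e. $B^p$ is the zero operator, with associated operators $A_1,\dots,A_{2p}$ and spaces $X_0=X,X_1,\dots,X_p$. Then the homogeneous equation $$B\frac{dx}{dt}=x,\quad 0\le t<\infty,$$ has only the trivial solution $x\equiv 0$. Moreover, let $f:[0,\infty)\to X$ be sufficiently smooth, in the sense that all derivatives $\frac{dx_p}{dt},\dots,\frac{dx_1}{dt}$ occurring in the formulas below, and the derivative of the resulting function $x$, exist on $[0,\infty)$. Then the unique solution of the nonhomogeneous equation $$B\frac{dx}{dt}=x(t)+f(t),\quad 0\le t<\infty,$$ is given by $$x(t)=-f(t)+A_1\frac{dx_1}{dt}(t),$$ where $x_1$ is obtained from the recursion $$x_p(t)=-A_{2p}A_{2p-2}\cdots A_2f(t),$$ $$x_i(t)=-A_{2i}A_{2i-2}\cdots A_2f(t)+A_{2i+1}\frac{dx_{i+1}}{dt}(t),\qquad i=p-1,\dots,1.$$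
   Context: Skeleton chain. Let $X$ be a Banach space, $B:X\to X$ a linear operator, and $p\ge1$ an integer. Let $X_0:=X$, let $X_1,\dots,X_p$ be normed linear spaces, and let $$A_{2i}:X_{i-1}\to X_i,\qquad A_{2i-1}:X_i\to X_{i-1},\qquad i=1,\dots,p,$$ be bounded linear operators. Put $B^0:=B$ and $B^i:=A_{2i}A_{2i-1}:X_i\to X_i$ for $i=1,\dots,p$. The superscript is an index of the chain, not a power of $B$. Suppose that: 1) $B=A_1A_2$, and $A_{2i}A_{2i-1}=A_{2i+1}A_{2i+2}$ for $i=1,\dots,p-1$; 2) the operators $B^0,B^1,\dots,B^{p-1}$ are not invertible (have no bounded everywhere-defined inverse), and $B^p:X_p\to X_p$ is either continuously invertible (bijective with bounded inverse) or the zero operator. Then $\{B^i\}_{i=0}^p$ is called an (attached) skeleton chain of $B$ of length $p$. It is called regular if $B^p$ is continuously invertible, and degenerate if $B^p$ is the zero operator. A solution is a differentiable function $x:[0,\infty)\to X$ (norm derivative, one-sided at $t=0$) that satisfies the equation for all $t\ge0$; no initial condition is imposed. *)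

(* Defs.v *)
From mathcomp Require Import all_boot all_order all_algebra.
From mathcomp Require Import all_classical.
From mathcomp Require Import topology normedtype derive.

Set Implicit Arguments.
Unset Strict Implicit.
Unset Printing Implicit Defensive.

Import Order.TTheory GRing.Theory Num.Theory.
Import numFieldNormedType.Exports.

Local Open Scope classical_set_scope.
Local Open Scope ring_scope.

(* The scalar field K is any numFieldType, so real and complex Banach spaces
   are both covered.  In such a K, 0 <= t forces t to be real: for K the reals
   or the complex numbers, [set t : K | 0 <= t] is the half-line [0, oo).
   A function on the half-line is a total function K -> V, of which only the
   values at 0 <= t are ever used. *)

Section halfline.
Context {K : numFieldType} {V : normedModType K}.
Implicit Types (x : K -> V) (t : K).

(* Increments h <> 0 that keep t + h in the half-line tend to 0; at t = 0 this
   yields the one-sided derivative. *)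
Definition halfline_incr t : set_system K := within [set h | 0 <= t + h] 0^'.

Definition hquotient x t (h : K) : V := h^-1 *: (x (t + h) - x t).

Definition hderivable x t : Prop := cvg (hquotient x t @ halfline_incr t).

Definition hderive x t : V := lim (hquotient x t @ halfline_incr t).

End halfline.

Section operators.
Context {K : numFieldType}.

Definition bounded_op {V W : normedModType K} (T : V -> W) : Prop :=
  exists M : K, forall v, `|T v| <= M * `|v|.

Definition cont_invertible {V : normedModType K} (T : V -> V) : Prop :=
  exists S : {linear V -> V}, [/\ bounded_op S, cancel T S & cancel S T].

End operators.

(* The spaces X_0 = X and X_i = Y i for i >= 1; Y 0 is never used. *)
Definition chain_space {K : numFieldType} (X : completeNormedModType K)
    (Y : nat -> normedModType K) (i : nat) : normedModType K :=
  if i is _.+1 then Y i else X.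

Section chain.
Context {K : numFieldType} {X : completeNormedModType K}.
Context {Y : nat -> normedModType K}.
Local Notation "'X_ i" := (chain_space X Y i) (at level 8, i at level 2).

(* Aeven i stands for A_(2i+2) and Aodd i for A_(2i+1); a chain of length p
   only involves the indices i < p. *)
Variables (Aeven : forall i, {linear 'X_i -> 'X_(i.+1)}).
Variables (Aodd : forall i, {linear 'X_(i.+1) -> 'X_i}).

(* B^i, where the superscript is the index in the chain. *)
Definition chain_op (B : {linear X -> X}) (i : nat) : 'X_i -> 'X_i :=
  match i with
  | 0 => B
  | j.+1 => fun v => Aeven j (Aodd j v)
  end.

Record skeleton_chain (B : {linear X -> X}) (p : nat) : Prop := SkeletonChain {
  chain_pos : (0 < p)%N;
  chain_bounded_even : forall i, (i < p)%N -> bounded_op (Aeven i);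
  chain_bounded_odd : forall i, (i < p)%N -> bounded_op (Aodd i);
  chain_factor0 : forall v : X, B v = Aodd 0%N (Aeven 0%N v);
  chain_factorS : forall i, (i.+1 < p)%N -> forall v : 'X_(i.+1),
    Aeven i (Aodd i v) = Aodd i.+1 (Aeven i.+1 v);
  chain_not_invertible : forall i, (i < p)%N ->
    ~ cont_invertible (chain_op B (i := i));
  chain_end : cont_invertible (chain_op B (i := p)) \/
    forall v : 'X_p, chain_op B v = 0
}.

Definition degenerate_skeleton_chain (B : {linear X -> X}) (p : nat) : Prop :=
  skeleton_chain B p /\ forall v : 'X_p, chain_op B v = 0.

(* A_(2i) A_(2i-2) ... A_2 f *)
Fixpoint even_image (f : K -> X) (i : nat) : K -> 'X_i :=
  match i with
  | 0 => f
  | j.+1 => fun t => Aeven j (even_image f j t)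
  end.

End chain.

(* Main.v *)
Require Import Defs.
From mathcomp Require Import all_boot all_order all_algebra.
From mathcomp Require Import all_classical.
From mathcomp Require Import topology normedtype derive.
Import Order.TTheory GRing.Theory Num.Theory.
Import numFieldNormedType.Exports.
Local Open Scope ring_scope.

(** Write [E_i = A_(2i) ... A_2] (so [E_0] is the identity) and let [B^i] be the
    operators of the chain.  The chain relations say that
    [B^i = A_(2i+1) A_(2i+2)] for [i < p], whereas [B^i = A_(2i) A_(2i-1)] by
    definition, so each [A_(2i+2)] intertwines [B^i] with [B^(i+1)]; hence
    [E_i B = B^i E_i] ([even_image_chain_op]).  The [A_(2i)] are bounded, so
    they commute with differentiation ([is_hderive_linear]).

    Homogeneous equation.  If [x = B x'], put [w_i = E_i x].  Then
    [w_i = B^i E_i x' = A_(2i+1) w_(i+1)'] for [i < p], and [w_p = B^p E_p x']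
    is zero because the chain is degenerate.  The derivative of zero is zero, so
    [w_(p-1)], ..., [w_0 = x] vanish one after the other
    ([homogeneous_trivial]).

    Nonhomogeneous equation.  With [x_0 = x], the formula for [x] is one more
    step of the recursion.  Applying [A_(2i+2)] to the formula for [x_i] and
    rewriting [A_(2i+2) A_(2i+1) x_(i+1)'] as [A_(2i+3) A_(2i+4) x_(i+1)'], or
    as [0] when [i = p - 1], gives the formula for [x_(i+1)] by descending
    induction, so [A_(2i+2) x_i = x_(i+1)]: the sequence is made of the images
    [E_i x] ([recursion_shift]).  In particular [x_1' = A_2 x'], and the formula
    for [x] reads [x + f = A_1 A_2 x' = B x'].  Uniqueness is the homogeneous case
    applied to a difference of two solutions. *)

Section HalflineDerivative.
Set Implicit Arguments.
Unset Strict Implicit.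
Unset Printing Implicit Defensive.
Context {K : numFieldType}.
Implicit Types (V W : normedModType K) (t : K).

(** A relational form of the derivative, which carries existence and value
    together. *)
Definition is_hderive {V} (x : K -> V) t (l : V) : Prop :=
  (hquotient x t @ halfline_incr t --> l)%classic.

#[local] Instance halfline_incr_filter t : Filter (halfline_incr t).
Proof. exact: within_filter. Qed.

(** Limits along [halfline_incr t] are unique only for [0 <= t]: arbitrarily
    small positive increments then stay in the half-line. *)
Lemma halfline_incr_proper t : 0 <= t -> ProperFilter (halfline_incr t).
Proof.
move=> t0; apply: Build_ProperFilter_ex => A.
rewrite /halfline_incr /within /= => /nbhs_ballP[e /= e0 eA].
have e20 : 0 < e / 2 by rewrite divr_gt0.
exists (e / 2); apply: eA; last by rewrite /= addr_ge0// ltW.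
- by rewrite /ball /= sub0r normrN gtr0_norm// gtr_pMr// invf_lt1// ltr1n.
- by rewrite gt_eqF.
Qed.

Lemma is_hderiveP {V} (x : K -> V) t :
  hderivable x t -> is_hderive x t (hderive x t).
Proof. by []. Qed.

Lemma is_hderive_hderivable {V} (x : K -> V) t l :
  is_hderive x t l -> hderivable x t.
Proof. by move=> xl; apply/cvg_ex; exists l. Qed.

Lemma is_hderive_val {V} (x : K -> V) t l :
  0 <= t -> is_hderive x t l -> hderive x t = l.
Proof.
by move=> t0 xl; have := halfline_incr_proper t0 => ?; apply: cvg_lim.
Qed.

(** Only the values on the half-line enter the derivative, although functions
    are total on [K]. *)
Lemma eq_is_hderive {V} (x y : K -> V) t l : 0 <= t ->
  (forall s, 0 <= s -> x s = y s) -> is_hderive x t l -> is_hderive y t l.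
Proof.
move=> t0 xy; apply: cvg_trans; apply: near_eq_cvg.
rewrite /halfline_incr near_withinE; near=> h => /= th0.
by rewrite /hquotient !xy.
Unshelve. all: by end_near. Qed.

Lemma is_hderive0 {V} t : is_hderive (fun=> 0 : V) t 0.
Proof.
rewrite /is_hderive (_ : hquotient _ _ = fun=> 0); first exact: cvg_cst.
by apply/funext => h; rewrite /hquotient subrr scaler0.
Qed.

Lemma is_hderiveB {V} (x y : K -> V) t l m :
  is_hderive x t l -> is_hderive y t m ->
  is_hderive (fun s => x s - y s) t (l - m).
Proof.
move=> xl ym; rewrite /is_hderive.
rewrite (_ : hquotient _ _ = fun h => hquotient x t h - hquotient y t h).
  exact: cvgB.
apply/funext => h; rewrite /hquotient -scalerBr; congr (_ *: _).
by rewrite !opprD !opprK addrACA.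
Qed.

Lemma bounded_op_continuous {V W} (T : {linear V -> W}) :
  bounded_op T -> continuous T.
Proof.
move=> [M TM]; apply: bounded_linear_continuous; apply/ex_bound.
(* [M] may fail to be comparable with [0] when [V] is trivial, hence the norm *)
exists `|M|; apply/nbhs_norm0P; exists 1 => //= v /= v1.
have Mv0 : 0 <= M * `|v| by apply: le_trans (TM v).
apply: le_trans (TM v) _.
by rewrite -(ger0_norm Mv0) normrM normr_id ler_piMr// ltW.
Qed.

Lemma is_hderive_linear {V W} (T : {linear V -> W}) (x : K -> V) t l :
  bounded_op T -> is_hderive x t l -> is_hderive (fun s => T (x s)) t (T l).
Proof.
move=> /bounded_op_continuous Tc xl; rewrite /is_hderive.
rewrite (_ : hquotient _ _ = T \o hquotient x t).
  exact: (cvg_comp _ _ xl (Tc l)).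
by apply/funext => h; rewrite /hquotient /= linearZ /= (linearB T).
Qed.

End HalflineDerivative.

Section SkeletonChain.
Set Implicit Arguments.
Unset Strict Implicit.
Unset Printing Implicit Defensive.
Context {K : numFieldType} {X : completeNormedModType K}.
Context {Y : nat -> normedModType K} {B : {linear X -> X}} {p : nat}.
Context {Aeven : forall i, {linear chain_space X Y i -> chain_space X Y i.+1}}.
Context {Aodd : forall i, {linear chain_space X Y i.+1 -> chain_space X Y i}}.
Hypothesis chainB : skeleton_chain Aeven Aodd B p.

Lemma chain_op_factor i (v : chain_space X Y i) : (i < p)%N ->
  chain_op Aeven Aodd B v = Aodd i (Aeven i v).
Proof.
case: i v => [|i] v ip; first exact: (chain_factor0 chainB).
exact: (chain_factorS chainB).
Qed.

Lemma even_image_chain_op (f : K -> X) i t : (i <= p)%N ->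
  even_image Aeven (fun s => B (f s)) i t
  = chain_op Aeven Aodd B (even_image Aeven f i t).
Proof.
by elim: i => [//|i IHi] ip /=; rewrite IHi ?(ltnW ip)// chain_op_factor.
Qed.

Lemma is_hderive_even_image (x x' : K -> X) t i : (i <= p)%N ->
  is_hderive x t (x' t) ->
  is_hderive (even_image Aeven x i) t (even_image Aeven x' i t).
Proof.
move=> + xx'; elim: i => [//|i IHi] ip /=.
apply: is_hderive_linear (IHi (ltnW ip)).
exact: (chain_bounded_even chainB).
Qed.

Lemma eq_even_image (f g : K -> X) i t :
  f t = g t -> even_image Aeven f i t = even_image Aeven g i t.
Proof. by move=> fg; elim: i => [//|i IHi] /=; rewrite IHi. Qed.

Hypothesis degenerateB :
  forall v : chain_space X Y p, chain_op Aeven Aodd B v = 0.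

Lemma homogeneous_trivial (x : K -> X) :
  (forall t : K, 0 <= t -> hderivable x t /\ B (hderive x t) = x t) ->
  forall t : K, 0 <= t -> x t = 0.
Proof.
move=> xP.
have wE i (t : K) : (i <= p)%N -> 0 <= t -> even_image Aeven x i t
    = chain_op Aeven Aodd B (even_image Aeven (hderive x) i t).
  move=> ip t0; rewrite -even_image_chain_op//; apply: eq_even_image.
  by have [_ ->] := xP t t0.
suff w0 n : (n <= p)%N -> forall t : K, 0 <= t -> even_image Aeven x (p - n) t = 0.
  by move=> t t0; have := w0 p (leqnn p) t t0; rewrite subnn.
elim: n => [_ t t0|n IHn np t t0]; first by rewrite subn0 wE// degenerateB.
have ip : (p - n.+1 < p)%N by rewrite ltn_subrL /= (leq_trans _ np).
have iS : (p - n.+1).+1 = (p - n)%N by rewrite -subSn.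
move: (p - n.+1)%N ip iS => i ip iS; rewrite -iS in IHn.
rewrite wE ?(ltnW ip)// chain_op_factor//.
have [xt _] := xP t t0.
have d1 := is_hderive_even_image (x' := hderive x) ip (is_hderiveP xt).
have d0 : is_hderive (even_image Aeven x i.+1) t 0.
  apply: (eq_is_hderive t0 _ (is_hderive0 t)) => s s0.
  by rewrite IHn// ltnW.
rewrite -[Aeven i _]/(even_image Aeven (hderive x) i.+1 t).
by rewrite -(is_hderive_val t0 d1) (is_hderive_val t0 d0) linear0.
Qed.

(** Going down from [i = p - 1], since the formula for [x_(i+1)] involves the
    derivative of [x_(i+2)], which has to be recognised as that of
    [A_(2i+4) x_(i+1)].  At [i = p - 1] degeneracy removes the derivative
    term. *)
Lemma recursion_shift (f : K -> X) (z : forall i, K -> chain_space X Y i) :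
  (forall t : K, 0 <= t -> z p t = - even_image Aeven f p t) ->
  (forall i, (i < p)%N -> forall t : K, 0 <= t ->
     z i t = - even_image Aeven f i t + Aodd i (hderive (z i.+1) t)) ->
  (forall i, (0 < i <= p)%N -> forall t : K, 0 <= t -> hderivable (z i) t) ->
  forall i, (i < p)%N -> forall t : K, 0 <= t -> Aeven i (z i t) = z i.+1 t.
Proof.
move=> zp zi zd.
suff H n i : (i + n.+1)%N = p -> forall t : K, 0 <= t -> Aeven i (z i t) = z i.+1 t.
  by move=> i ip; apply: (H (p - i.+1)%N); rewrite addnS -addSn subnKC.
elim: n i => [|n IHn] i ip t t0.
  have iSp : i.+1 = p by rewrite -addn1.
  rewrite zi -?iSp// linearD linearN /=.
  move: zp degenerateB; rewrite -iSp => zp deg.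
  by rewrite zp// [X in _ + X](deg (hderive (z i.+1) t)) addr0.
have iSp : (i.+1 < p)%N by rewrite -ip addnS addnS !ltnS leq_addr.
rewrite zi ?(ltnW iSp)// linearD linearN /= zi//=; congr (_ + _).
rewrite (chain_factorS chainB)//; congr (Aodd i.+1 _).
apply/esym/(is_hderive_val t0).
apply: (@eq_is_hderive _ _ (fun s => Aeven i.+1 (z i.+1 s)))=> //.
  by move=> s s0; apply: IHn; rewrite ?addSnnS.
apply: is_hderive_linear; first exact: (chain_bounded_even chainB).
by apply/is_hderiveP/zd => //=; exact: ltnW.
Qed.

End SkeletonChain.

Theorem theorem2 (K : numFieldType) (X : completeNormedModType K)
    (Y : nat -> normedModType K) (B : {linear X -> X}) (p : nat)
    (Aeven : forall i, {linear chain_space X Y i -> chain_space X Y i.+1})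
    (Aodd : forall i, {linear chain_space X Y i.+1 -> chain_space X Y i})
    (chainB : degenerate_skeleton_chain Aeven Aodd B p) :
  (forall x : K -> X,
     (forall t : K, 0 <= t -> hderivable x t /\ B (hderive x t) = x t) ->
     forall t : K, 0 <= t -> x t = 0)
  /\
  (forall (f : K -> X) (x_ : forall i, K -> chain_space X Y i),
     (forall t : K, 0 <= t -> x_ p t = - even_image Aeven f p t) ->
     (forall i, (0 < i < p)%N -> forall t : K, 0 <= t ->
        x_ i t = - even_image Aeven f i t + Aodd i (hderive (x_ i.+1) t)) ->
     let x := fun t : K => - f t + Aodd 0%N (hderive (x_ 1%N) t) in
     (forall i, (0 < i <= p)%N -> forall t : K, 0 <= t -> hderivable (x_ i) t) ->
     (forall t : K, 0 <= t -> hderivable x t) ->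
     (forall t : K, 0 <= t -> hderivable x t /\ B (hderive x t) = x t + f t) /\
     (forall y : K -> X,
        (forall t : K, 0 <= t -> hderivable y t /\ B (hderive y t) = y t + f t) ->
        forall t : K, 0 <= t -> y t = x t)).
Proof.
have [chain deg] := chainB; have p0 := chain_pos chain.
split=> [|f x_ xp xi x xd xd0]; first exact: (homogeneous_trivial chain deg).
have xP t : 0 <= t -> hderivable x t /\ B (hderive x t) = x t + f t.
  move=> t0; split; first exact: xd0.
  (* the recursion extended to index 0 by [x] in place of the free [x_ 0] *)
  pose z i : K -> chain_space X Y i :=
    if i is j.+1 return K -> chain_space X Y i then x_ j.+1 else x.
  have zp s : 0 <= s -> z p s = - even_image Aeven f p s.
    by move: p0 xp; rewrite /z; case: (p) => // q _; apply.
  have zi i : (i < p)%N -> forall s, 0 <= s ->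
      z i s = - even_image Aeven f i s + Aodd i (hderive (z i.+1) s).
    by case: i => [//|i] ip s s0; apply: xi.
  have zd i : (0 < i <= p)%N -> forall s, 0 <= s -> hderivable (z i) s.
    by case: i => // i; apply: xd.
  have A2x := recursion_shift chain deg zp zi zd p0.
  have x1' : is_hderive (x_ 1%N) t (Aeven 0%N (hderive x t)).
    apply: (eq_is_hderive t0 A2x); apply: is_hderive_linear.
      exact: (chain_bounded_even chain).
    exact/is_hderiveP/xd0.
  rewrite (chain_factor0 chain) -(is_hderive_val t0 x1') /x.
  by rewrite addrAC addNr add0r.
split=> // y yP t t0; apply/eqP; rewrite -subr_eq0; apply/eqP.
apply: (homogeneous_trivial chain deg (x := fun s => y s - x s)) => // s s0.
have [ys yE] := yP s s0; have [xs xE] := xP s s0.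
have d := is_hderiveB (is_hderiveP ys) (is_hderiveP xs).
split; first exact: is_hderive_hderivable d.
by rewrite (is_hderive_val s0 d) linearB yE xE opprD addrACA subrr addr0.
Qed.
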